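(* Let $d\le n$ and $k\le n$ be positive integers, $\bm a_1,\dots,\bm a_n\in\mathbb{R}^d$, $\lambda>0$, and $\tilde k:=\min\{k,d\}$. Then the problem $$z_k:=\min_{S\subseteq [n]}\left\{\operatorname{tr}\left(\left(\sum_{i\in S}\bm a_i\bm a_i^{\top}+\lambda \bm I_d\right)^{-1}\right): |S|=k\right\}$$ is equivalent to the following convex integer program: $$z_k=\min_{\bm x\in\{0,1\}^n}\left\{\operatorname{conv}\Gamma\left(\sum_{i\in[n]}x_i\bm a_i\bm a_i^{\top};\lambda\right)+\frac{d-\tilde k}{\lambda}:\ \sum_{i\in[n]}x_i=k\right\},$$ where $\operatorname{conv}\Gamma$ is the convex function defined in the context.
   Context: $[n]=\{1,\dots,n\}$ and $[s,n]=\{s,\dots,n\}$; $\mathcal S_+^d$ is the set of $d\times d$ symmetric positive semidefinite matrices. For $\bm X\in\mathcal S_+^d$ with eigenvalues $\sigma_1\ge\cdots\ge\sigma_d\ge0$, $\Gamma(\bm X;\lambda):=\sum_{i\in[\tilde k]}\frac1{\sigma_i+\lambda}$. The function $\operatorname{conv}\Gamma(\cdot;\lambda)$ is the convex envelope (largest convex underestimator) of $\Gamma(\cdot;\lambda)$ on $\mathcal S_+^d$; explicitly, $$\operatorname{conv}\Gamma(\bm X;\lambda)=\sum_{i\in[\eta]}\frac1{\sigma_i+\lambda}+\frac{(\tilde k-\eta)^2}{\sum_{i\in[\eta+1,d]}\sigma_i+(\tilde k-\eta)\lambda},$$ where $0\le\eta\le\tilde k-1$ is the unique integer with $\sigma_\eta>\frac1{\tilde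 k-\eta}\sum_{i\in[\eta+1,d]}\sigma_i\ge\sigma_{\eta+1}$, with the convention $\sigma_0=\infty$. *)

(* Defs.v *)
From HB Require Import structures.
From mathcomp Require Import all_boot all_order all_algebra.
From mathcomp Require Import boolp classical_sets reals convex.

Set Implicit Arguments.
Unset Strict Implicit.
Unset Printing Implicit Defensive.

Import Order.TTheory GRing.Theory Num.Theory.

Local Open Scope classical_set_scope.
Local Open Scope ring_scope.

Definition is_min (R : realType) (A : set R) (z : R) : Prop :=
  A z /\ lbound A z.

Definition psd (R : realType) (d : nat) : set 'M[R]_d :=
  [set X | X \is symmetricmx /\ forall v : 'cV[R]_d, 0 <= (v^T *m X *m v) 0 0].

(* The eigenvalues with multiplicity, in nonincreasing order. Such a list is
   unique when it exists, which is the case for every symmetric X; the default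
   [::] is only returned when the characteristic polynomial of X does not split
   over R. Indices start at 0: sigma_i is (eigvals X)`_i.-1. *)
Definition eigvals (R : realType) (d : nat) (X : 'M[R]_d) : seq R :=
  xget [::] [set s : seq R | sorted >=%R s /\
                             char_poly X = \prod_(z <- s) ('X - z%:P)].

Definition Gamma (R : realType) (d kt : nat) (lambda : R) (X : 'M[R]_d) : R :=
  \sum_(i < kt) ((eigvals X)`_i + lambda)^-1.

Definition convex_underestimator (R : realType) (E : lmodType R)
    (D : set E) (f g : E -> R) : Prop :=
  convex_function (D : set (convex_lmodType E)) g /\
  forall x, D x -> g x <= f x.

(* The largest convex underestimator of f on D, as a pointwise supremum. Only
   its values on D are meaningful, and only when f has a convex underestimator
   on D. For f = Gamma with lambda > 0 and D = psd, the constant 0 is one. *)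
Definition convex_envelope (R : realType) (E : lmodType R)
    (D : set E) (f : E -> R) (x : E) : R :=
  sup [set g x | g in convex_underestimator D f].

Definition convGamma (R : realType) (d kt : nat) (lambda : R) :
    'M[R]_d -> R :=
  convex_envelope (psd (R:=R) (d:=d)) (Gamma kt lambda).

(* Main.v *)
Require Import Defs.
From HB Require Import structures.
From mathcomp Require Import all_boot all_order all_algebra.
From mathcomp Require Import boolp classical_sets reals convex.
From mathcomp Require Import unstable interval_inference complex lra.

(* No formula for the envelope is needed. The function
   g(X) = tr (X + lambda I)^-1 - (d - kt) / lambda is convex on psd matrices,
   and g(X) = Gamma(X) + \sum_(kt < i <= d) (1/(sigma_i + lambda) - 1/lambda)
   is at most Gamma(X), with equality when X has rank at most kt. Hence
   g <= convGamma <= Gamma, with equality throughout on matrices of rank at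
   most kt, in particular on sums of k rank-one matrices. *)

Set Implicit Arguments.
Unset Strict Implicit.
Unset Printing Implicit Defensive.

Import Order.TTheory GRing.Theory Num.Theory.

Local Open Scope classical_set_scope.
Local Open Scope ring_scope.

(** * Real diagonalization of symmetric matrices *)

Lemma symmetricmxP (R : fieldType) d (X : 'M[R]_d) :
  reflect (X^T = X) (X \is symmetricmx).
Proof.
by apply: (iffP (is_hermitianmxP _ _ _)); rewrite expr0 scale1r map_mx_id.
Qed.

(** Over [R[i]] the matrix is Hermitian, so the complex spectral theorem diagonalizes it with a real
    spectrum; the similarity is then brought back to [R]. An invertible [P] suffices below;
    orthogonality is not kept. *)
Lemma symmetricmx_diagonalizable (R : rcfType) d (X : 'M[R]_d) :
  X \is symmetricmx ->
  exists (P : 'M[R]_d) (r : 'rV[R]_d),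
    P \in unitmx /\ X = invmx P *m diag_mx r *m P.
Proof.
move=> Xsym; set toC : {rmorphism R -> R[i]} := real_complex R.
set A := map_mx toC X.
have toC_real m n (M : 'M[R]_(m, n)) :
    map_mx toC M \is a mxOver (Num.real : {pred R[i]}).
  by apply/mxOverP => i j; rewrite mxE; apply/complex_realP; eexists.
have real_toC m n (M : 'M[R[i]]_(m, n)) : M \is a mxOver (Num.real : {pred R[i]}) ->
    {N : 'M[R]_(m, n) | M = map_mx toC N}.
  move=> Mreal; exists (map_mx (@complex.Re R) M); apply/matrixP => i j; rewrite !mxE.
  by apply/esym/RRe_real/(mxOverP Mreal).
have Aherm : A \is hermsymmx.
  apply: realsym_hermsym (toC_real _ _ _); apply/symmetricmxP.
  by rewrite map_trmx (symmetricmxP _ Xsym).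
have [r rE] := real_toC _ _ _ (hermitian_spectral_diag_real Aherm).
have /orthomx_spectralP := hermitian_normalmx Aherm.
rewrite rE => AE.
have Dreal : diag_mx (map_mx toC r) \is a mxOver (Num.real : {pred R[i]}).
  by rewrite -map_diag_mx.
have AD : similar_in unitmx A (diag_mx (map_mx toC r)).
  exists (spectralmx A); first exact: spectral_unit.
  by apply/similarRL; rewrite ?spectral_unit // {2}AE !mulmxA mulmxV ?spectral_unit //
     mul1mx mulmxK ?spectral_unit.
(* Real matrices that are similar over the complex numbers are similar through a real invertible
   matrix, which replaces the unitary [spectralmx A]. *)
have [Q] := real_similar AD (toC_real _ _ _) Dreal.
rewrite inE => /andP[/real_toC[P ->]]; rewrite map_unitmx => Punit.
move=> /similarRL; rewrite map_unitmx => /(_ Punit).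
rewrite -map_diag_mx /A -map_invmx -!map_mxM => /map_mx_inj DE.
exists P, r; split=> //.
by rewrite DE !mulmxA mulVmx // mul1mx mulmxKV.
Qed.

(** * Positive semidefinite matrices *)

Lemma mulmx_tr_gt0 (R : realDomainType) d (v : 'rV[R]_d) :
  v != 0 -> 0 < (v *m v^T) 0 0.
Proof.
move=> v0; rewrite mxE lt0r sumr_ge0 => [|i _]; last by rewrite mxE -expr2 sqr_ge0.
rewrite andbT; apply: contraNneq v0 => /eqP; rewrite psumr_eq0 => [/allP v0|i _];
  last by rewrite mxE -expr2 sqr_ge0.
apply/eqP/rowP => i; have := v0 i (mem_index_enum _).
by rewrite !mxE mulf_eq0 orbb => /eqP.
Qed.

Lemma psd_row (R : realType) d (X : 'M[R]_d) (v : 'rV[R]_d) :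
  psd X -> 0 <= (v *m X *m v^T) 0 0.
Proof. by case=> _ /(_ v^T); rewrite trmxK. Qed.

Lemma psd_conv (R : realType) d (X Y : 'M[R]_d) (s t : R) :
  0 <= s -> 0 <= t -> psd X -> psd Y -> psd (s *: X + t *: Y).
Proof.
move=> s0 t0 [/symmetricmxP Xs Xp] [/symmetricmxP Ys Yp]; split.
  by apply/symmetricmxP; rewrite linearD !linearZ /= Xs Ys.
move=> v; rewrite mulmxDr mulmxDl -!scalemxAr -!scalemxAl !mxE.
by have:= Xp v; have := Yp v; rewrite !mxE => ? ?; rewrite addr_ge0 ?mulr_ge0.
Qed.

Lemma psd_scalar (R : realType) d (l : R) : 0 <= l -> psd (l%:M : 'M_d).
Proof.
move=> l0; split; first by apply/symmetricmxP; rewrite tr_scalar_mx.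
move=> v; rewrite -mulmxA mul_scalar_mx -scalemxAr mxE mulr_ge0 //.
by rewrite mxE sumr_ge0 // => i _; rewrite mxE -expr2 sqr_ge0.
Qed.

(** The quadratic form at [v] is the square of the scalar [a^T v]. *)
Lemma psd_rank1 (R : realType) d (a : 'cV[R]_d) : psd (a *m a^T).
Proof.
split; first by apply/symmetricmxP; rewrite trmx_mul trmxK.
move=> v; rewrite mulmxA -mulmxA -[v^T *m a]trmxK trmx_mul trmxK.
by rewrite mxE big_ord1 [X in X * _]mxE -expr2 sqr_ge0.
Qed.

Lemma psd_add (R : realType) d (X Y : 'M[R]_d) : psd X -> psd Y -> psd (X + Y).
Proof.
by move=> ? ?; rewrite -[X]scale1r -[Y]scale1r; apply: psd_conv.
Qed.

(** A row [v] in the kernel satisfies [v X v^T + l v v^T = 0]; the first term is nonnegative, and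
    the second is positive unless [v = 0]. *)
Lemma psd_add_scalar_unit (R : realType) d (X : 'M[R]_d) (l : R) :
  0 < l -> psd X -> X + l%:M \in unitmx.
Proof.
move=> l0 Xp; rewrite -row_free_unit -kermx_eq0; apply/rowV0P => v /sub_kermxP vX.
apply/eqP; apply: contraTT isT => /mulmx_tr_gt0 v0.
have := psd_row v Xp; have : (v *m (X + l%:M) *m v^T) 0 0 = 0 by rewrite vX mul0mx mxE.
rewrite mulmxDr mul_mx_scalar mulmxDl -scalemxAl mxE [X in _ + X]mxE => e X0.
by have := mulr_gt0 l0 v0; lra.
Qed.

(** Each diagonal entry is the quadratic form of [X] at a row of [W]. *)
Lemma psd_trace_ge0 (R : realType) d m (X : 'M[R]_d) (W : 'M_(m, d)) :
  psd X -> 0 <= \tr (W *m X *m W^T).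
Proof.
move=> Xp; apply: sumr_ge0 => i _.
have -> : (W *m X *m W^T) i i = (row i W *m X *m (row i W)^T) 0 0.
  rewrite -row_mul tr_row !mxE; apply: eq_bigr => j _.
  by rewrite !mxE; congr (_ * _); apply: eq_bigr => h _; rewrite mxE.
exact: psd_row.
Qed.

(** * Convexity of the trace of the inverse *)

(* Z A Z with Z = A^-1 - Y is psd and equals A^-1 - 2 Y + Y A Y. *)
Lemma trace_invmx_tangent (R : realType) d (A Y : 'M[R]_d) :
  psd A -> A \in unitmx -> Y \is symmetricmx ->
  \tr Y *+ 2 - \tr (Y *m A *m Y) <= \tr (invmx A).
Proof.
move=> Ap Au /symmetricmxP Ys; have [/symmetricmxP As _] := Ap.
have := psd_trace_ge0 (invmx A - Y) Ap.
rewrite linearB /= trmx_inv As Ys mulmxBl mulVmx // mulmxBr mulmxBl mul1mx.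
rewrite mulmxBl mul1mx mulmxK // !linearB /= mulr2n.
by move=> ?; lra.
Qed.

Lemma trace_invmx_convex (R : realType) d (A B : 'M[R]_d) (s t : R) :
  psd A -> psd B -> A \in unitmx -> B \in unitmx ->
  0 <= s -> 0 <= t -> s + t = 1 -> s *: A + t *: B \in unitmx ->
  \tr (invmx (s *: A + t *: B)) <= s * \tr (invmx A) + t * \tr (invmx B).
Proof.
move=> Ap Bp Au Bu s0 t0 st1 Cu; set C := s *: A + t *: B in Cu *.
(* The tangent bounds of A and B at Y = C^-1 add up to tr C^-1. *)
have [/symmetricmxP Cs _] : psd C by exact: psd_conv.
have Ys : invmx C \is symmetricmx by apply/symmetricmxP; rewrite trmx_inv Cs.
have := lerD (ler_wpM2l s0 (trace_invmx_tangent Ap Au Ys))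
             (ler_wpM2l t0 (trace_invmx_tangent Bp Bu Ys)).
apply: le_trans.
have : \tr (invmx C *m C *m invmx C) = \tr (invmx C) by rewrite mulVmx // mul1mx.
rewrite {2}/C mulmxDr mulmxDl -!scalemxAr -!scalemxAl linearD !linearZ /= => e.
rewrite mulr2n !mulrBr; set x := \tr (invmx C) in e *; nra.
Qed.

(** * Convex envelopes as pointwise suprema *)

Lemma i01_ge0 (R : numDomainType) (t : {i01 R}) : 0 <= interval_inference.Itv.r t.
Proof. exact: (ge0 t). Qed.

Lemma i01_le1 (R : numDomainType) (t : {i01 R}) : interval_inference.Itv.r t <= 1.
Proof. exact: (le1 t). Qed.

(** The underestimator [g] makes the set of values at [x] nonempty, so that its supremum inherits
    the upper bound [f x]. *)
Lemma convex_envelope_le (R : realType) (E : lmodType R) (D : set E)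
    (f g : E -> R) (x : E) :
  convex_underestimator D f g -> D x -> convex_envelope D f x <= f x.
Proof.
move=> fg Dx; apply: ge_sup; first by exists (g x), g.
by move=> _ [h [_ hf] <-]; exact: hf.
Qed.

(** The values at [x] are bounded by [f x], so the supremum really dominates each of them. *)
Lemma convex_envelope_ge (R : realType) (E : lmodType R) (D : set E)
    (f g : E -> R) (x : E) :
  convex_underestimator D f g -> D x -> g x <= convex_envelope D f x.
Proof.
move=> fg Dx; apply: ub_le_sup; last by exists g.
by exists (f x) => _ [h [_ hf] <-]; exact: hf.
Qed.

(** A supremum of convex functions is convex: each [h] in the family lies below the envelope at both
    endpoints, hence so does its convexity bound. *)
Lemma convex_envelope_convex (R : realType) (E : lmodType R) (D : set E)
    (f g : E -> R) :
  convex_underestimator D f g ->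
  convex_function (D : set (convex_lmodType E)) (convex_envelope D f).
Proof.
move=> fg t x y xD yD; apply: ge_sup; first by exists (g (conv t x y)), g.
move=> _ [h fh <-]; have [hc _] := fh.
have h_le z : z \in D -> h z <= convex_envelope D f z.
  by move=> /set_mem; exact: convex_envelope_ge.
apply: le_trans (hc t x y xD yD) _; rewrite !convRE.
by apply: lerD; apply: ler_wpM2l;
  do ?[exact: i01_ge0|exact: h_le|exact/onem_ge0/i01_le1].
Qed.

(** * Eigenvalues, rank and trace read off a diagonalization *)

Section Eigenvalues.
Variables (R : realType) (d : nat) (X : 'M[R]_d) (P : 'M[R]_d) (r : 'rV[R]_d).
Hypotheses (Pu : P \in unitmx) (XE : X = invmx P *m diag_mx r *m P).

Lemma similar_diag_char_poly :
  char_poly X = \prod_(i < d) ('X - (r 0 i)%:P).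
Proof using Pu XE.
have -> : char_poly X = char_poly (diag_mx r).
  rewrite /char_poly /char_poly_mx XE !map_mxM map_invmx.
  set Q := map_mx polyC P.
  have Qu : Q \in unitmx by rewrite map_unitmx.
  (* Scalar matrices commute with [Q], so the whole characteristic matrix is a conjugate and the
     determinants of [Q] and its inverse cancel. *)
  have {1}-> : 'X%:M = invmx Q *m 'X%:M *m Q :> 'M[{poly R}]_d.
    by rewrite scalar_mxC mulmxKV.
  rewrite -mulmxBl -mulmxBr !det_mulmx mulrC mulrA -det_mulmx.
  by rewrite mulmxV // det1 mul1r.
rewrite char_poly_trig ?diag_mx_is_trig //.
by apply: eq_bigr => i _; rewrite !mxE eqxx.
Qed.

(** The sorted diagonal is an admissible list, so [xget] does not fall back on its default; unique
    factorization into linear factors then identifies the chosen list up to order. *)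
Lemma eigvals_similar_diag :
  sorted >=%R (eigvals X) /\ perm_eq (eigvals X) [seq r 0 i | i : 'I_d].
Proof using Pu XE.
set s0 := sort >=%R [seq r 0 i | i : 'I_d].
have cE : char_poly X = \prod_(z <- [seq r 0 i | i : 'I_d]) ('X - z%:P).
  by rewrite similar_diag_char_poly big_map big_enum.
have [ss sE] : sorted >=%R (eigvals X) /\
     char_poly X = \prod_(z <- eigvals X) ('X - z%:P).
  apply: (@xgetPex _ [::] [set s : seq R | sorted >=%R s /\
                             char_poly X = \prod_(z <- s) ('X - z%:P)]).
  exists s0; split; first by apply: sort_sorted => x y; apply: le_total.
  by rewrite cE; apply: perm_big; rewrite perm_sym perm_sort.
by split=> //; apply: prod_XsubC_eq; rewrite -sE.
Qed.

(** The submatrix of [diag_mx r] on the nonzero entries is invertible, and a submatrix has at most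
    the rank of the full matrix. *)
Lemma card_rank_similar_diag : (#|[pred i : 'I_d | r 0%R i != 0%R]| <= \rank X)%N.
Proof using Pu XE.
have -> : \rank X = \rank (diag_mx r).
  rewrite XE mxrankMfree ?row_free_unit //.
  by rewrite -mxrank_tr trmx_mul mxrankMfree ?mxrank_tr // row_free_unit
     unitmx_tr unitmx_inv.
set A := [pred i : 'I_d | r 0 i != 0]; pose f (i : 'I_#|A|) := enum_val i.
have Du : mxsub f f (diag_mx r) \in unitmx.
  have -> : mxsub f f (diag_mx r) = diag_mx (\row_i r 0 (f i)).
    by apply/matrixP => i j; rewrite !mxE (inj_eq enum_val_inj).
  rewrite unitmxE det_diag unitfE; apply/prodf_neq0 => i _.
  by rewrite mxE; exact: (enum_valP i).
rewrite -[leqLHS](mxrank_unit Du) mxsubrc (leq_trans (mxrankS (rowsub_sub _ _))) //.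
by rewrite -mxrank_tr trmx_mxsub (leq_trans (mxrankS (rowsub_sub _ _))) // mxrank_tr.
Qed.

Lemma trace_invmx_similar_diag (l : R) : (forall i, r 0 i + l != 0) ->
  \tr (invmx (X + l%:M)) = \sum_i (r 0 i + l)^-1.
Proof using Pu XE.
move=> rl; pose e := \row_i (r 0 i + l)^-1.
suff -> : invmx (X + l%:M) = invmx P *m diag_mx e *m P.
  rewrite -mulmxA mxtrace_mulC mulmxK // mxtrace_diag.
  by apply: eq_bigr => i _; rewrite mxE.
have E1 : (invmx P *m diag_mx e *m P) *m (X + l%:M) = 1%:M.
  have -> : X + l%:M = invmx P *m (diag_mx r + l%:M) *m P.
    rewrite XE mulmxDr mulmxDl; congr (_ + _).
    by rewrite scalar_mxC -mulmxA mulVmx // mulmx1.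
  rewrite !mulmxA mulmxK // -(mulmxA (invmx P)).
  have -> : diag_mx e *m (diag_mx r + l%:M) = 1%:M.
    rewrite -diag_const_mx -linearD mulmx_diag -diag_const_mx; congr diag_mx.
    by apply/rowP => i; rewrite !mxE mulVf.
  by rewrite mulmx1 mulVmx.
have [_ u] := mulmx1_unit E1.
by rewrite -[LHS]mul1mx -E1 mulmxK.
Qed.

(** Row [i] of [P] is a nonzero left eigenvector for [r 0 i], so the quadratic form there is [r 0 i]
    times a positive number. *)
Lemma psd_similar_diag_ge0 : psd X -> forall i, 0 <= r 0 i.
Proof using Pu XE.
move=> Xp i; have := psd_row (row i P) Xp.
have -> : row i P *m X = r 0 i *: row i P.
  by rewrite -row_mul XE !mulmxA mulmxV // mul1mx row_mul row_diag_mx -scalemxAl -rowE.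
rewrite -scalemxAl mxE pmulr_lge0 //; apply: mulmx_tr_gt0.
by apply: contraTneq Pu => P0; rewrite -row_free_unit; apply/row_freeP => -[B PB];
   have := congr1 (row i) PB; rewrite row_mul P0 mul0mx => /rowP /(_ i);
   rewrite !mxE eqxx => /eqP; rewrite eq_sym oner_eq0.
Qed.

End Eigenvalues.

Lemma psd_eigvals (R : realType) d (X : 'M[R]_d) (l : R) :
  psd X -> 0 < l ->
  [/\ size (eigvals X) = d,
      forall i, 0 <= (eigvals X)`_i,
      forall i, (\rank X <= i)%N -> (eigvals X)`_i = 0
    & \tr (invmx (X + l%:M)) = \sum_(i < d) ((eigvals X)`_i + l)^-1].
Proof.
move=> Xp l0; have [P [r [Pu XE]]] := symmetricmx_diagonalizable (proj1 Xp).
have [ss sp] := eigvals_similar_diag Pu XE; have r0 := psd_similar_diag_ge0 Pu XE Xp.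
have sd : size (eigvals X) = d by rewrite (perm_size sp) size_image card_ord.
have s0 i : 0 <= (eigvals X)`_i.
  have [id|di] := ltnP i d; last by rewrite nth_default ?sd.
  have : (eigvals X)`_i \in eigvals X by rewrite mem_nth ?sd.
  by rewrite (perm_mem sp) => /mapP[j _ ->].
split=> // [i ri|].
  have [id|di] := ltnP i d; last by rewrite nth_default ?sd.
  (* By contraposition: if the entry at index [i] is nonzero, it is positive, and by monotonicity so
     are all the first [i.+1] entries. Hence there are more than [i] nonzero eigenvalues, and the
     rank exceeds [i]. *)
  apply/eqP; apply: contraTT ri => si; rewrite -ltnNge.
  apply: leq_trans (card_rank_similar_diag Pu XE).
  have -> : #|[pred i : 'I_d | r 0 i != 0]| = count (fun x => x != 0) (eigvals X).
    by rewrite (permP sp) count_map cardE size_filter enumT.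
  rewrite -(cat_take_drop i.+1 (eigvals X)) count_cat -[leqLHS]addn0 leq_add //.
  have sz : size (take i.+1 (eigvals X)) = i.+1 by rewrite size_takel ?sd.
  rewrite -{1}sz leq_eqVlt eq_sym -all_count; apply/orP; left.
  apply/(all_nthP 0) => j; rewrite sz => ji; rewrite nth_take //.
  have : (eigvals X)`_i <= (eigvals X)`_j.
    by apply: (sorted_leq_nth (@ge_trans _ R) (@ge_refl _ R) 0 ss);
       rewrite ?inE ?sd //; apply: leq_ltn_trans id.
  by move=> ij; rewrite gt_eqF //; apply: lt_le_trans ij; rewrite lt0r si s0.
rewrite (trace_invmx_similar_diag Pu XE) => [|i]; last by rewrite gt_eqF // ltr_wpDl.
transitivity (\sum_(x <- eigvals X) (x + l)^-1).
  by rewrite (perm_big _ sp) /= big_map big_enum.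
by rewrite (big_nth 0) sd big_mkord.
Qed.

(** * The envelope of [Gamma] at matrices of low rank *)

Lemma psd_convex_function_trace (R : realType) d (l : R) : 0 < l ->
  convex_function (@psd R d : set (convex_lmodType 'M[R]_d))
    (fun X : 'M[R]_d => \tr (invmx (X + l%:M))).
Proof.
move=> l0 t X Y /set_mem Xp /set_mem Yp; rewrite convRE.
set u := interval_inference.Itv.r t.
have u0 : 0 <= u by exact: i01_ge0.
have v0 : 0 <= onem u by exact/onem_ge0/i01_le1.
have uv : u + onem u = 1 by exact: add_onemK.
(* The weights sum to 1, so the shift by [l%:M] distributes over the convex combination. *)
have CE : (conv t X Y : 'M[R]_d) + l%:M =
    u *: (X + l%:M) + onem u *: (Y + l%:M) :> 'M[R]_d.
  by rewrite !scalerDr addrACA -scalerDl uv scale1r.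
have Cu : (conv t X Y : 'M[R]_d) + l%:M \in unitmx.
  by apply: psd_add_scalar_unit => //; apply: psd_conv.
rewrite CE in Cu *; apply: trace_invmx_convex; rewrite ?psd_add_scalar_unit //.
- by apply: psd_add => //; apply/psd_scalar/ltW.
- by apply: psd_add => //; apply/psd_scalar/ltW.
Qed.

Lemma convex_function_subr (R : realType) (E : lmodType R) (D : set E)
    (f : E -> R) (c : R) :
  convex_function (D : set (convex_lmodType E)) f ->
  convex_function (D : set (convex_lmodType E)) (fun x => f x - c).
Proof.
move=> fc t x y xD yD; have := fc t x y xD yD; rewrite !convRE /onem.
by set u := interval_inference.Itv.r t => h; nra.
Qed.

Section GammaEnvelope.
Variables (R : realType) (d kt : nat) (l : R).
Hypotheses (l_gt0 : 0 < l) (kt_le_d : (kt <= d)%N).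

Lemma trace_invmx_Gamma (X : 'M[R]_d) : psd X ->
  \tr (invmx (X + l%:M)) =
  Gamma kt l X + \sum_(kt <= i < d) ((eigvals X)`_i + l)^-1.
Proof using l_gt0 kt_le_d.
move=> Xp; have [_ _ _ ->] := psd_eigvals Xp l_gt0.
rewrite /Gamma -!(big_mkord xpredT (fun i => ((eigvals X)`_i + l)^-1)).
exact: big_cat_nat.
Qed.

(** Each of the [d - kt] tail terms of the trace is at most [1 / l], because the eigenvalues are
    nonnegative. *)
Lemma Gamma_convex_underestimator :
  convex_underestimator (@psd R d) (Gamma kt l)
    (fun X => \tr (invmx (X + l%:M)) - (d - kt)%:R / l).
Proof using l_gt0 kt_le_d.
split; first exact/convex_function_subr/psd_convex_function_trace.
move=> X Xp; rewrite lerBlDr trace_invmx_Gamma // lerD2l.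
rewrite mulr_natl -sumr_const_nat; apply: ler_sum => i _.
have [_ s0 _ _] := psd_eigvals Xp l_gt0.
by rewrite lef_pV2 ?posrE ?ler_wpDl // ltr_wpDl.
Qed.

Lemma convGamma_low_rank (X : 'M[R]_d) : psd X -> (\rank X <= kt)%N ->
  convGamma kt l X + (d - kt)%:R / l = \tr (invmx (X + l%:M)).
Proof using l_gt0 kt_le_d.
move=> Xp rX; have gf := Gamma_convex_underestimator.
have GE : Gamma kt l X = \tr (invmx (X + l%:M)) - (d - kt)%:R / l.
  rewrite trace_invmx_Gamma //; have [_ _ s0 _] := psd_eigvals Xp l_gt0.
  (* Indices start at 0, so rank at most [kt] makes exactly the entries of this tail vanish, and
     each term equals [1 / l]. *)
  suff -> : \sum_(kt <= i < d) ((eigvals X)`_i + l)^-1 = (d - kt)%:R / l by rewrite addrK.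
  rewrite mulr_natl -sumr_const_nat; apply: eq_big_nat => i /andP[ki _].
  by rewrite s0 ?add0r // (leq_trans rX).
apply/eqP; rewrite eq_sym -subr_eq -GE eq_le.
by rewrite (convex_envelope_le gf) // [leLHS]GE (convex_envelope_ge gf).
Qed.

End GammaEnvelope.

(** * From subsets to 0/1 vectors *)

Lemma psd_sum_rank1 (R : realType) n d (a : 'I_n -> 'cV[R]_d) (S : {set 'I_n}) :
  psd (\sum_(i in S) a i *m (a i)^T).
Proof.
elim/big_ind: _ => [|X Y|i _]; [|exact: psd_add|exact: psd_rank1].
by rewrite -[0](scale0r 1%:M) scalemx1; exact: psd_scalar.
Qed.

Lemma rank_sum_rank1 (F : fieldType) n d (a : 'I_n -> 'cV[F]_d) (S : {set 'I_n}) :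
  (\rank (\sum_(i in S) a i *m (a i)^T)%R <= #|S|)%N.
Proof.
rewrite -sum1_card; elim/big_rec2: _ => [|i m M _ IH]; first by rewrite mxrank0.
rewrite (leq_trans (mxrank_add _ _)) // leq_add //.
by rewrite (leq_trans (mxrankM_maxl _ _)) ?rank_leq_col.
Qed.

Theorem theorem4 (R : realType) (n d k : nat) (a : 'I_n -> 'cV[R]_d)
    (lambda : R) (d_gt0 : (0 < d)%N) (k_gt0 : (0 < k)%N)
    (d_le_n : (d <= n)%N) (k_le_n : (k <= n)%N) (lambda_gt0 : 0 < lambda) :
  let kt := minn k d in
  convex_function (@psd R d : set (convex_lmodType 'M[R]_d))
    (convGamma kt lambda) /\
  exists z : R,
    is_min [set \tr (invmx (\sum_(i in S) a i *m (a i)^T + lambda%:M))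
           | S in [set S : {set 'I_n} | #|S| = k]] z /\
    is_min [set convGamma kt lambda (\sum_(i < n) x 0 i *: (a i *m (a i)^T))
                + (d - kt)%:R / lambda
           | x in [set x : 'rV[R]_n | (forall i, x 0 i = 0 \/ x 0 i = 1) /\
                                      \sum_(i < n) x 0 i = k%:R]] z.
Proof.
move=> kt; have ktd : (kt <= d)%N by exact: geq_minr.
split; first exact: convex_envelope_convex (Gamma_convex_underestimator lambda_gt0 ktd).
pose tr_inv (S : {set 'I_n}) :=
  \tr (invmx (\sum_(i in S) a i *m (a i)^T + lambda%:M)).
pose ind (S : {set 'I_n}) : 'rV[R]_n := \row_i (i \in S)%:R.
have indE S :
    \sum_(i < n) ind S 0 i *: (a i *m (a i)^T) = \sum_(i in S) a i *m (a i)^T.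
  rewrite [RHS]big_mkcond; apply: eq_bigr => i _; rewrite mxE.
  by case: (i \in S); rewrite ?scale1r ?scale0r.
have ind_card S : \sum_(i < n) ind S 0 i = #|S|%:R.
  rewrite -sum1_card natr_sum [RHS]big_mkcond; apply: eq_bigr => i _; rewrite mxE.
  by case: (i \in S).
(* The choice [kt = minn k d] matters here: the rank is at most [#|S| = k] as a sum of rank-one
   terms, and at most [d] by size. *)
have valE (S : {set 'I_n}) : #|S| = k ->
    convGamma kt lambda (\sum_(i < n) ind S 0 i *: (a i *m (a i)^T)) +
      (d - kt)%:R / lambda = tr_inv S.
  move=> Sk; rewrite indE convGamma_low_rank //; first exact: psd_sum_rank1.
  by rewrite leq_min rank_leq_row -{1}Sk rank_sum_rank1.
(* The feasible vectors are exactly the indicators of [k]-subsets, so both problems range over the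
   same set of values. *)
have -> : [set convGamma kt lambda (\sum_(i < n) x 0 i *: (a i *m (a i)^T))
                + (d - kt)%:R / lambda
           | x in [set x : 'rV[R]_n | (forall i, x 0 i = 0 \/ x 0 i = 1) /\
                                      \sum_(i < n) x 0 i = k%:R]]
    = [set tr_inv S | S in [set S : {set 'I_n} | #|S| = k]].
  apply/seteqP; split=> z [].
    move=> x [x01 xk] <-; pose S := [set i | x 0 i == 1]%SET.
    have xE : x = ind S.
      apply/rowP => i; rewrite !mxE inE.
      by case: (x01 i) => ->; rewrite ?eqxx // eq_sym oner_eq0.
    have Sk : #|S| = k by apply/eqP; rewrite -(eqr_nat R) -ind_card -xE xk.
    by exists S => //; rewrite xE valE.
  move=> S Sk <-; exists (ind S); last exact: valE.
  split=> [i|]; last by rewrite ind_card Sk.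
  by rewrite mxE; case: (i \in S); [right|left].
(* The first [k] indices form a feasible set, available since [k <= n]; a minimum over finitely many
   subsets is then attained. *)
have [S0 S0k] : exists S : {set 'I_n}, #|S| == k.
  exists [set widen_ord k_le_n i | i : 'I_k]%SET.
  rewrite card_imset ?card_ord // => i j /(congr1 val) /= ij; exact: val_inj.
have [S Sk Smin] := @arg_minP _ _ _ S0 [pred S : {set 'I_n} | #|S| == k] tr_inv S0k.
have S_min : is_min [set tr_inv S | S in [set S : {set 'I_n} | #|S| = k]] (tr_inv S).
  by split; [exists S => //; apply/eqP | move=> _ [T Tk <-]; apply/Smin/eqP].
by exists (tr_inv S).
Qed.
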